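(* Let $k$ be a field of characteristic not $2$, let $V$ be a vector space of dimension $n$ over $k$, and let $t\in SL(V)$. Suppose $n\not\equiv 2\pmod 4$. Then $t$ is real in $SL(V)$ if and only if $t$ is strongly real in $SL(V)$.
   Context: $SL(V)$ is the group of $k$-linear automorphisms of $V$ of determinant $1$. An element $t$ of a group $\mathcal G$ is real in $\mathcal G$ if it is conjugate to $t^{-1}$ in $\mathcal G$; an involution is an element $s$ with $s^2=1$ (the identity is allowed); $t$ is strongly real in $\mathcal G$ if it is a product of two involutions of $\mathcal G$. *)

(* Defs.v *)
From HB Require Import structures.
From mathcomp Require Import all_boot all_order all_algebra.

Set Implicit Arguments.
Unset Strict Implicit.
Unset Printing Implicit Defensive.

Import GRing.Theory passmx.
Local Open Scope ring_scope.

Section RealElements.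
Local Open Scope group_scope.
Variable G : groupType.
Implicit Types s t : G.

Definition is_real t : Prop := exists g : G, t ^ g = t^-1.

(* The identity counts as an involution. *)
Definition involution s : Prop := s ^+ 2 = 1.

Definition strongly_real t : Prop :=
  exists s1 s2 : G, [/\ involution s1, involution s2 & t = s1 * s2].

End RealElements.

Section Determinant.
Variables (k : fieldType) (V : vectType k).
Implicit Types f g : 'End(V).

Definition lfun_det f : k := \det (mxof (vbasis {:V}) (vbasis {:V}) f).

Lemma lfun_det_basis (e : (\dim {:V}).-tuple V) f :
  basis_of {:V} e -> lfun_det f = \det (mxof e e f).
Proof.
move=> eB; have bB := vbasisP {:V}.
have PQ : mxof e (vbasis {:V}) \1 *m mxof (vbasis {:V}) e \1 = 1%:M.
  by rewrite -mxof_comp // comp_lfun1l mxof1 ?(basis_free eB).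
have -> : mxof e e f = mxof e (vbasis {:V}) \1
    *m mxof (vbasis {:V}) (vbasis {:V}) f *m mxof (vbasis {:V}) e \1.
  by rewrite -!mxof_comp // comp_lfun1l comp_lfun1r.
by rewrite !det_mulmx mulrAC -det_mulmx PQ det1 mul1r.
Qed.

Lemma lfun_det1 : lfun_det \1 = 1.
Proof. by rewrite /lfun_det mxof1 ?det1 ?(basis_free (vbasisP _)). Qed.

Lemma lfun_detM f g : lfun_det (f \o g) = lfun_det f * lfun_det g.
Proof.
by rewrite /lfun_det (mxof_comp _ _ (vbasisP {:V})) det_mulmx mulrC.
Qed.

Lemma lfun_det_ker0 f : lfun_det f != 0 -> lker f == 0%VS.
Proof.
move=> nz; apply/lker0P => u v fuv.
apply: (can_inj (rVofK (vbasisP {:V}))).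
have inj : injective (mulmxr (mxof (vbasis {:V}) (vbasis {:V}) f)
                       : 'rV_(\dim {:V}) -> 'rV_(\dim {:V})).
  by apply: (can_inj (mulmxK _)); rewrite unitmxE unitfE.
by apply: inj; rewrite /= -!rVof_app ?vbasisP // fuv.
Qed.

End Determinant.

Section SpecialLinearGroup.
Variables (k : fieldType) (V : vectType k).

Record SL : predArgType := MkSL {
  slval :> 'End(V);
  _ : lfun_det slval == 1
}.

HB.instance Definition _ := [isSub for slval].
HB.instance Definition _ := [Choice of SL by <:].

Implicit Types f g h : SL.

Lemma SL_det f : lfun_det f = 1.
Proof. exact/eqP/(valP f). Qed.

Lemma SL_ker0 f : lker f == 0%VS.
Proof. by apply: lfun_det_ker0; rewrite SL_det oner_neq0. Qed.

Fact SL_one_subproof : lfun_det (\1%VF : 'End(V)) == 1.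
Proof. by rewrite lfun_det1. Qed.
Definition SL_one := MkSL SL_one_subproof.

Fact SL_mul_subproof f g : lfun_det (f \o g) == 1.
Proof. by rewrite lfun_detM !SL_det mulr1. Qed.
Definition SL_mul f g := MkSL (SL_mul_subproof f g).

Fact SL_inv_subproof f : lfun_det (f^-1)%VF == 1.
Proof.
have := lfun_det1 V; rewrite -(lker0_compfV (SL_ker0 f)) lfun_detM SL_det.
by rewrite mul1r => ->.
Qed.
Definition SL_inv f := MkSL (SL_inv_subproof f).

Fact SL_mulA : associative SL_mul.
Proof. by move=> f g h; apply: val_inj; rewrite /= comp_lfunA. Qed.
Fact SL_1mul : left_id SL_one SL_mul.
Proof. by move=> f; apply: val_inj; rewrite /= comp_lfun1l. Qed.
Fact SL_mul1 : right_id SL_one SL_mul.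
Proof. by move=> f; apply: val_inj; rewrite /= comp_lfun1r. Qed.
Fact SL_mulV : left_inverse SL_one SL_inv SL_mul.
Proof. by move=> f; apply: val_inj; rewrite /= lker0_compVf ?SL_ker0. Qed.
Fact SL_Vmul : right_inverse SL_one SL_inv SL_mul.
Proof. by move=> f; apply: val_inj; rewrite /= lker0_compfV ?SL_ker0. Qed.

HB.instance Definition _ :=
  isGroup.Build SL SL_mulA SL_1mul SL_mul1 SL_mulV SL_Vmul.

End SpecialLinearGroup.

(* Main.v *)
(* If [g] conjugates [t] to its inverse then [h(t)] and [h(t^-1)] have the same
   rank for every polynomial [h], and this property passes to invariant direct
   summands.  Take [u] whose annihilator is the minimal polynomial [p] of [t],
   of degree [d].  The span of the [t^i u], [i < d], has an invariant complement,
   and [p(t^-1) = 0] implies that the reversal [t^i u |-> t^(d-1-i) u] is an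
   involution of this span inverting [t]; its determinant is [(-1)^(d./2)].
   Induction on [n], with sign changes on odd-dimensional summands, gives an
   involution inverting [t] of determinant [(-1)^(n./2)]; a last sign change
   makes it 1 if [n] is 3 mod 4. *)
Require Import Defs.
From mathcomp Require Import all_boot all_order all_algebra.
From Stdlib Require Import Classical.

Set Implicit Arguments.
Unset Strict Implicit.
Unset Printing Implicit Defensive.

Import GRing.Theory passmx.
Local Open Scope ring_scope.

(** * Irreducible factors and multiplicities *)

Section Polynomials.
Variable k : fieldType.
Implicit Types p q : {poly k}.

(** Irreducibility is not decidable over an arbitrary field, hence the classical case split; a
    proper nonconstant divisor has smaller size. *)
Lemma irreducible_factor p :
  (1 < size p)%N -> exists2 q, irreducible_poly q & q %| p.
Proof.
have [n] := ubnP (size p); elim: n p => // n IHn p lepn p_gt1.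
case: (classic (irreducible_poly p)) => [irr|nirr]; first by exists p.
apply: NNPP => noq; apply: nirr; split=> // q q1 qp.
have p0 : p != 0 by rewrite -size_poly_gt0 ltnW.
have q0 : q != 0 by apply: contraNneq p0 => q0; rewrite -dvd0p -q0.
have q_gt1 : (1 < size q)%N by rewrite ltn_neqAle eq_sym q1 size_poly_gt0.
apply: contraT => neq; case: noq.
have ltqp : (size q < size p)%N.
  by rewrite ltn_neqAle dvdp_leq // andbT (dvdp_size_eqp qp).
have [|r irr rq] := IHn q _ q_gt1.
  by rewrite -ltnS; apply: leq_trans lepn.
by exists r => //; apply: dvdp_trans qp.
Qed.

Lemma irreducible_valuation q p : irreducible_poly q -> p != 0 ->
  exists a p', p = q ^+ a * p' /\ coprimep q p'.
Proof.
move=> irr; have [n] := ubnP (size p); elim: n p => // n IHn p lepn p0.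
have [cop|] := boolP (coprimep q p); first by exists 0%N, p; rewrite mul1r.
move=> ncop; have /dvdpP[r pE] : q %| p.
  have gq : gcdp q p %= q by apply: irr; rewrite ?dvdp_gcdl.
  by rewrite -(eqp_dvdl _ gq) dvdp_gcdr.
have r0 : r != 0 by apply: contraNneq p0 => r0; rewrite pE r0 mul0r.
have q0 := irredp_neq0 irr.
have [|a [p' [rE cop]]] := IHn r _ r0.
  rewrite -ltnS; apply: leq_trans lepn; rewrite ltnS pE size_mul //.
  by case: irr; case: (size q) => [|[|s]] // _ _; rewrite !addnS /= ltnS leq_addr.
by exists a.+1, p'; split=> //; rewrite pE rE exprSr mulrAC.
Qed.

End Polynomials.

(** * Annihilators of vectors, up to the minimal polynomial *)

Section Annihilator.
Variables (k : fieldType) (n : nat) (A : 'M[k]_n.+1).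
Implicit Types (u v : 'rV[k]_n.+1) (p q h : {poly k}).

Definition annihilator u p :=
  forall h, (u *m horner_mx A h == 0) = (p %| h).

Lemma mul_horner_mxM m (W : 'M_(m, _)) p q :
  W *m horner_mx A (p * q) = W *m horner_mx A p *m horner_mx A q.
Proof. by rewrite rmorphM /= -mulmxA mulmxE. Qed.

Lemma annihilator_exists u : exists2 p, p != 0 & annihilator u p.
Proof.
pose p := mxminpoly A.
have p0 : p != 0 by apply/monic_neq0/mxminpoly_monic.
have : u *m horner_mx A p = 0 by rewrite mx_root_minpoly mulmx0.
move: p p0 => p; have [m] := ubnP (size p); elim: m p => // m IHm p lepm p0 up0.
case: (classic (annihilator u p)) => [?|nann]; first by exists p.
apply: NNPP => noq; apply: nann => h; apply/eqP/idP => [uh0|]; last first.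
  by case/dvdpP=> q ->; rewrite mulrC mul_horner_mxM up0 mul0mx.
apply: contraT; rewrite /dvdp => r0; case: noq; apply: (IHm (h %% p)) => //.
  by rewrite -ltnS; apply: leq_trans lepm; rewrite ltnS ltn_modp.
have := uh0; rewrite {1}(divp_eq h p) rmorphD mulmxDr mulrC /=.
by rewrite mul_horner_mxM up0 mul0mx add0r.
Qed.

Lemma annihilator_mul u p q :
  p != 0 -> annihilator u (p * q) -> annihilator (u *m horner_mx A p) q.
Proof. by move=> p0 an h; rewrite -mul_horner_mxM an dvdp_mul2l. Qed.

(** If [h] kills [u + v], then [h * q] kills [u], so [p] divides [h * q] and hence [h];
    symmetrically for [q]. *)
Lemma annihilator_add u v p q : coprimep p q ->
  annihilator u p -> annihilator v q -> annihilator (u + v) (p * q).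
Proof.
move=> cop au av h; rewrite Gauss_dvdp //.
apply/eqP/andP => [uv0|[]]; last first.
  by rewrite -au -av mulmxDl => /eqP-> /eqP->; rewrite addr0.
have h2 r : u *m horner_mx A (h * r) + v *m horner_mx A (h * r) = 0.
  by rewrite -mulmxDl mul_horner_mxM uv0 mul0mx.
split.
  rewrite -(@Gauss_dvdpl _ h q p) // -au; apply/eqP.
  have /eqP : v *m horner_mx A (h * q) == 0 by rewrite av dvdp_mull.
  by have := h2 q => /[swap] ->; rewrite addr0.
rewrite -(@Gauss_dvdpl _ h p q) 1?coprimep_sym // -av; apply/eqP.
have /eqP : u *m horner_mx A (h * p) == 0 by rewrite au dvdp_mull.
by have := h2 p => /[swap] ->; rewrite add0r.
Qed.

(* Some irreducible divides [q] more often than [p]: exchange its power in [p]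
   for its power (up to one more than in [p]) in [q]. *)
Lemma annihilator_grow u v p q :
    p != 0 -> q != 0 -> annihilator u p -> annihilator v q -> ~~ (q %| p) ->
  exists w r, annihilator w r /\ (size p < size r)%N.
Proof.
move=> p0 q0 au av nqp; pose g := gcdp p q.
have g0 : g != 0 by rewrite gcdp_eq0 (negbTE p0).
have pE : p = p %/ g * g by rewrite divpK ?dvdp_gcdl.
have qE : q = q %/ g * g by rewrite divpK ?dvdp_gcdr.
have cop : coprimep (p %/ g) (q %/ g) by rewrite coprimep_div_gcd ?p0.
have r0 : q %/ g != 0 by apply: contraNneq q0 => r0; rewrite qE r0 mul0r.
have r1 : (1 < size (q %/ g)%R)%N.
  rewrite ltn_neqAle size_poly_gt0 r0 andbT eq_sym; apply: contraNN nqp => r1.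
  rewrite qE pE dvdp_mul2r //; case/size_poly1P: r1 => c c0 ->.
  by rewrite -alg_polyC dvdpZl // dvd1p.
have [f irr fr] := irreducible_factor r1.
have [a [p' [paE fp']]] := irreducible_valuation irr p0.
have f0 := irredp_neq0 irr.
have p'0 : p' != 0 by apply: contraNneq p0 => p'0; rewrite paE p'0 mulr0.
have copf : coprimep f (p %/ g).
  by rewrite coprimep_sym; apply: coprimep_dvdl cop.
(* [f] is coprime to [p %/ g], so all of [f ^+ a] divides [g]; one more [f] comes from [q %/ g]. *)
have /dvdpP[s sE] : f ^+ a.+1 %| q.
  rewrite exprS qE dvdp_mul //.
  rewrite -(@Gauss_dvdpr _ g (p %/ g)) -?pE ?coprimep_expl //.
  by rewrite paE dvdp_mulr.
have s0 : s != 0 by apply: contraNneq q0 => s0; rewrite sE s0 mul0r.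
exists (u *m horner_mx A (f ^+ a) + v *m horner_mx A s), (p' * f ^+ a.+1).
split.
  apply: annihilator_add.
  - by rewrite coprimep_sym coprimep_expl.
  - by apply: annihilator_mul; rewrite ?expf_neq0 // -paE.
  - by apply: annihilator_mul; rewrite // -sE.
have -> : p' * f ^+ a.+1 = f * p by rewrite [in RHS]paE exprS mulrC mulrA.
rewrite size_mul //; case: irr.
by case: (size f) => [|[|m]] // _ _; rewrite addSn /= addSn ltnS leq_addl.
Qed.

(** As long as [p] does not kill [A], some basis vector has an annihilator not dividing [p], and the
    exchange yields a larger annihilator. Sizes are bounded by that of the minimal polynomial, so
    starting from the zero vector this stops. *)
Lemma cyclic_vector : exists u, annihilator u (mxminpoly A).
Proof.
have [p p0] := annihilator_exists 0; move: 0 => u au.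
have bound w r : annihilator w r -> r %| mxminpoly A.
  by move=> aw; rewrite -aw mx_root_minpoly mulmx0.
have mp0 : mxminpoly A != 0 by apply/monic_neq0/mxminpoly_monic.
have [m] := ubnP (size (mxminpoly A) - size p).
elim: m u p p0 au => // m IHm u p p0 au lem.
have [/eqP pA0|] := boolP (horner_mx A p == 0).
  exists u => h; rewrite au; apply: eqp_dvdl.
  by rewrite /eqp (bound u) //= mxminpoly_min.
move=> pA; have [i vi] : exists i, row i (horner_mx A p) != 0.
  apply/existsP; apply: contraNT pA; rewrite negb_exists => /forallP h.
  by apply/eqP/row_matrixP=> i; apply/eqP; rewrite row0 -[_ == _]negbK.
have [q q0 av] := annihilator_exists (delta_mx 0 i).
have [|w [r [aw ltr]]] := annihilator_grow p0 q0 au av.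
  by rewrite -av -rowE.
have ler := dvdp_leq mp0 (bound _ _ aw).
apply: (IHm w r) => //.
  by rewrite -size_poly_gt0 (leq_ltn_trans _ ltr).
rewrite -ltnS; apply: leq_trans lem.
by rewrite ltnS ltn_sub2l // (leq_trans ltr).
Qed.

End Annihilator.

(** * Polynomials in a matrix under similarity, blocks and transposition *)

Section PolynomialEvaluation.
Variable k : fieldType.
Implicit Types p q h : {poly k}.

(* Unlike [horner_mx], this makes sense for matrices of any size, 0 included. *)
Definition polymx n (A : 'M[k]_n) h : 'M[k]_n :=
  \sum_(i < size h) h`_i *: A ^+ i.

Lemma horner_polymx n (A : 'M[k]_n.+1) h : horner_mx A h = polymx A h.
Proof.
rewrite -{1}[h]coefK poly_def linear_sum; apply: eq_bigr => i _.
by rewrite linearZ /= rmorphXn /= horner_mx_X.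
Qed.

Lemma exprmx_intertwine m n (S : 'M_(m, n)) (A : 'M[k]_n) (B : 'M_m) i :
  S *m A = B *m S -> S *m A ^+ i = B ^+ i *m S.
Proof.
move=> SA; elim: i => [|i IHi]; first by rewrite !expr0 mulmx1 mul1mx.
by rewrite !exprS -!mulmxE mulmxA SA -mulmxA IHi mulmxA.
Qed.

Lemma polymx_intertwine m n (S : 'M_(m, n)) (A : 'M[k]_n) (B : 'M_m) h :
  S *m A = B *m S -> S *m polymx A h = polymx B h *m S.
Proof.
move=> SA; rewrite mulmx_sumr mulmx_suml; apply: eq_bigr => i _.
by rewrite -scalemxAr -scalemxAl (exprmx_intertwine i SA).
Qed.

Lemma rank_polymx_intertwine m n (S : 'M_(m, n)) S' (A : 'M[k]_n) (B : 'M_m) h :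
    S *m S' = 1%:M -> S' *m S = 1%:M -> S *m A = B *m S ->
  \rank (polymx A h) = \rank (polymx B h).
Proof.
move=> SS' S'S SA.
have fS : row_free S by apply/row_freeP; exists S'.
have uS : row_full S by apply/row_fullP; exists S'.
by rewrite -(eqmxMfull _ uS) (polymx_intertwine h SA) mxrankMfree.
Qed.

Lemma polymx_block m n (A : 'M[k]_m) (B : 'M_n) h :
  polymx (block_mx A 0 0 B) h = block_mx (polymx A h) 0 0 (polymx B h).
Proof.
have powE i : block_mx A 0 0 B ^+ i = block_mx (A ^+ i) 0 0 (B ^+ i).
  elim: i => [|i IHi]; first by rewrite !expr0 -!idmxE -scalar_mx_block.
  rewrite !exprS IHi -!mulmxE mulmx_block.
  by rewrite !(mulmx0, mul0mx, addr0, add0r).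
rewrite /polymx.
elim/big_rec3: _ => [|i X Y Z _ ->]; first by rewrite block_mx0.
by rewrite powE scale_block_mx !scaler0 add_block_mx !addr0.
Qed.

Lemma polymx_tr n (A : 'M[k]_n) h : polymx A^T h = (polymx A h)^T.
Proof.
rewrite linear_sum; apply: eq_bigr => i _; rewrite linearZ /=; congr (_ *: _).
elim: (nat_of_ord i) => [|j IHj]; first by rewrite !expr0 -idmxE trmx1.
by rewrite exprSr exprS -!mulmxE IHj trmx_mul.
Qed.

End PolynomialEvaluation.

(** * The order-reversing permutation matrix *)

Section Reversal.
Variable k : fieldType.

Definition revmx d : 'M[k]_d := \matrix_(i, j) (j == rev_ord i)%:R.

Lemma revmx_mul d m (M : 'M_(d, m)) i j : (revmx d *m M) i j = M (rev_ord i) j.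
Proof.
rewrite mxE (bigD1 (rev_ord i)) //= mxE eqxx mul1r big1 ?addr0 // => l nl.
by rewrite mxE (negbTE nl) mul0r.
Qed.

Lemma revmxK d : revmx d *m revmx d = 1%:M.
Proof. by apply/matrixP=> i j; rewrite revmx_mul !mxE rev_ordK eq_sym. Qed.

(** The first row has its only nonzero entry in the last column, with cofactor sign [(-1) ^+ d]; and
    [uphalf d] is [odd d + d./2]. *)
Lemma det_revmx d : \det (revmx d) = (-1) ^+ d./2.
Proof.
elim: d => [|d IHd]; first by rewrite det_mx00.
rewrite (expand_det_row _ ord0) (bigD1 ord_max) //= big1 ?addr0 => [|j nj].
  rewrite mxE -(inj_eq val_inj) /= subn1 eqxx mul1r /cofactor add0n /=.
  have -> : row' ord0 (col' ord_max (revmx d.+1)) = revmx d.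
    apply/matrixP=> i j; rewrite !mxE -!(inj_eq val_inj) [val (rev_ord _)]/=.
    by congr ((_ == _)%:R); first exact: lift_max.
  rewrite IHd uphalf_half exprD -{1}(odd_double_half d) exprD -mulrA -[RHS]mulr1.
  by rewrite -mul2n exprM sqrrN !expr1n mul1r mulr1.
rewrite mxE (_ : rev_ord ord0 = ord_max) ?(negbTE nj) ?mul0r //.
by apply: val_inj; rewrite /= subn1.
Qed.

End Reversal.

(** * Krylov matrices and the companion action *)

Section Krylov.
Variable k : fieldType.
Implicit Types p h : {poly k}.

Definition krylov n (A : 'M[k]_n) (u : 'rV[k]_n) d : 'M_(d, n) :=
  \matrix_(i < d) (u *m A ^+ i).

Lemma row_krylov n (A : 'M[k]_n) u d (i : 'I_d) :
  row i (krylov A u d) = u *m A ^+ i.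
Proof. exact: rowK. Qed.

Lemma mul_krylov n (A : 'M_n.+1) (u : 'rV[k]_n.+1) d (c : 'rV_d) :
  c *m krylov A u d = u *m horner_mx A (rVpoly c).
Proof.
rewrite mulmx_sum_row [rVpoly c]poly_def linear_sum mulmx_sumr.
apply: eq_bigr => i _; rewrite row_krylov valK linearZ /= -scalemxAr.
by rewrite rmorphXn /= horner_mx_X.
Qed.

(** For [p] of degree [d], this is multiplication by ['X] modulo [p] in the basis of powers of
    ['X]. *)
Definition companion d p : 'M[k]_d := \matrix_(i < d) poly_rV ('X ^+ i.+1 %% p).

Lemma companion_krylov n (A : 'M_n.+1) (u : 'rV[k]_n.+1) d p :
    size p = d.+1 -> horner_mx A p = 0 ->
  companion d p *m krylov A u d = krylov A u d *m A.
Proof.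
move=> sp Ap0; apply/row_matrixP=> i; rewrite !row_mul row_krylov rowK.
have p0 : p != 0 by rewrite -size_poly_gt0 sp.
rewrite mul_krylov poly_rV_K; last by rewrite -ltnS -sp ltn_modp.
rewrite -mulmxA mulmxE -exprSr; congr (_ *m _).
rewrite -[in RHS](horner_mx_X A) -rmorphXn /=.
by rewrite [in RHS](divp_eq ('X ^+ i.+1) p) rmorphD rmorphM /= Ap0 mulr0 add0r.
Qed.

(** A linear relation among the rows is a polynomial killing [u], too small to be a nonzero multiple
    of [p]. *)
Lemma krylov_free n (A : 'M_n.+1) (u : 'rV[k]_n.+1) d p :
  size p = d.+1 -> annihilator A u p -> row_free (krylov A u d).
Proof.
move=> sp au; rewrite -kermx_eq0; apply/rowV0P=> c /sub_kermxP.
rewrite mul_krylov => /eqP; rewrite au => pc; apply: (can_inj (@rVpolyK _ d)).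
rewrite linear0; apply/eqP; apply: contraLR pc => c0.
by rewrite /dvdp modp_small // sp ltnS size_poly.
Qed.

(* Reversal turns the Krylov matrix of [A] into one of [A^-1], on which the
   companion matrix acts as [A^-1] because [p] also kills [A^-1]. *)
Lemma companion_reverse n (A : 'M_n.+1) (u : 'rV[k]_n.+1) d p :
    A \in unitmx -> size p = d.+1 -> annihilator A u p ->
    horner_mx A p = 0 -> horner_mx A^-1 p = 0 ->
  let C := companion d p in let J := revmx k d in J *m C *m J *m C = 1%:M.
Proof.
move=> uA sp au Ap0 AVp0 C J.
have KC v : C *m krylov A v d = krylov A v d *m A by apply: companion_krylov.
have JK : J *m krylov A u d = krylov A^-1 (u *m A ^+ d.-1) d.
  apply/row_matrixP=> i.
  have -> : row i (J *m krylov A u d) = row (rev_ord i) (krylov A u d).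
    by apply/rowP=> j; rewrite [LHS]mxE revmx_mul [RHS]mxE.
  rewrite !row_krylov -mulmxA /=; congr (_ *m _).
  have -> : d.-1 = (d - i.+1 + i)%N.
    by rewrite -[in LHS](subnK (ltn_ord i)) addnS.
  by rewrite exprD mulmxE -mulrA exprVn mulrV ?mulr1 // unitrX.
(* The Krylov matrix can be cancelled on the right, so it suffices to compare the actions on it. *)
apply: (row_free_inj (krylov_free sp au)); rewrite mul1mx.
rewrite -!mulmxA KC (mulmxA J (krylov A u d)) JK (mulmxA C) companion_krylov // -JK.
by rewrite -mulmxA mulmxE mulVr // mulmx1 mulmxA revmxK mul1mx.
Qed.

End Krylov.

(** * Splitting off a cyclic summand *)

Section Splitting.
Variable k : fieldType.

(* For [f] dual to the last Krylov vector, the product is a Hankel matrix with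
   zeros above the antidiagonal and ones on it. *)
Lemma krylov_dual n (A : 'M[k]_n) (u : 'rV_n) e :
    row_free (krylov A u e.+1) ->
  exists f, krylov A u e.+1 *m (krylov A^T f e.+1)^T \in unitmx.
Proof.
set K := krylov A u e.+1 => fK.
have [phi Kphi] : exists phi : 'cV_n,
    forall i : 'I_e.+1, u *m A ^+ i *m phi = (i == ord_max)%:R%:M.
  exists (pinvmx K *m delta_mx ord_max 0) => i.
  rewrite -row_krylov -row_mul mulmxA mulmxVp // mul1mx.
  by apply/matrixP=> a b; rewrite !ord1 !mxE eqxx andbT mulr1n.
exists phi^T; set H := _ *m _.
have HE i j : H i j = (u *m A ^+ (i + j) *m phi) 0 0.
  have -> : H i j = (row i K *m (row j (krylov A^T phi^T e.+1))^T) 0 0.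
    by rewrite !mxE; apply: eq_bigr => l _; rewrite !mxE.
  rewrite !row_krylov trmx_mul trmxK exprD -mulmxE !mulmxA.
  congr ((_ *m _ *m _) 0 0).
  elim: (nat_of_ord j) => [|l IHl]; first by rewrite !expr0 -idmxE trmx1.
  by rewrite exprSr [RHS]exprS -!mulmxE trmx_mul trmxK IHl.
(* Reversing the rows moves the antidiagonal to the diagonal; the transpose is then lower
   unitriangular. *)
have /det_trig : is_trig_mx (revmx k e.+1 *m H)^T.
  apply/is_trig_mxP=> i j ltij; rewrite mxE revmx_mul HE.
  have lt : (rev_ord j + i < e)%N.
    have lej : (j <= e)%N by rewrite -ltnS.
    by rewrite /= subSS -[ltnRHS](subnK lej) ltn_add2l.
  have := Kphi (Ordinal (ltnW lt : (_ < e.+1)%N)) => /= ->.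
  by rewrite -(inj_eq val_inj) /= (ltn_eqF lt) mxE mul0rn.
rewrite det_tr big1 => [|i _]; last first.
  rewrite mxE revmx_mul HE /= subSS subnK; last by rewrite -ltnS.
  by have := Kphi ord_max => /= ->; rewrite eqxx mxE.
move=> det1; have : revmx k e.+1 *m H \in unitmx by rewrite unitmxE det1 unitr1.
by rewrite unitmx_mul => /andP[].
Qed.

(** The row space of [K] and the kernel of [Q] are both [A]-invariant, and invertibility of [K *m Q]
    makes them complementary. *)
Lemma complement_splitting m n d (A : 'M[k]_n) (K : 'M_(d, n)) (Q : 'M_(n, d)) C D :
    C *m K = K *m A -> A *m Q = Q *m D -> K *m Q \in unitmx -> m = (n - d)%N ->
  exists (B : 'M_m) (S : 'M_(d + m, n)) S',
    [/\ S *m S' = 1%:M, S' *m S = 1%:M & S *m A = block_mx C 0 0 B *m S].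
Proof.
move=> CK AQ uKQ mE.
have rQ : \rank Q = d.
  by apply/eqP; rewrite eqn_leq rank_leq_col -{1}(mxrank_unit uKQ) mxrankM_maxr.
(* A variable [m] can be replaced by this rank, the row count of [row_base]. *)
have {mE} mE : m = \rank (kermx Q) by rewrite mxrank_ker rQ.
subst m; have [W fW WE] : exists2 W : 'M_(\rank (kermx Q), n),
    row_free W & (W :=: kermx Q)%MS.
  by exists (row_base (kermx Q)); [exact: row_base_free | exact: eq_row_base].
have WQ : W *m Q = 0 by apply/sub_kermxP; rewrite WE.
have WA : (W *m A <= W)%MS.
  by rewrite WE; apply/sub_kermxP; rewrite -mulmxA AQ mulmxA WQ mul0mx.
have fS : row_free (col_mx K W).
  rewrite -kermx_eq0; apply/rowV0P=> c /sub_kermxP.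
  rewrite -[c]hsubmxK mul_row_col => c0.
  have l0 : lsubmx c = 0.
    have := congr1 (mulmx^~ Q) c0; rewrite mulmxDl -!mulmxA WQ mulmx0 addr0 mul0mx.
    by move/(congr1 (mulmx^~ (invmx (K *m Q)))); rewrite mulmxK // mul0mx.
  move: c0; rewrite l0 mul0mx add0r => r0.
  suff -> : rsubmx c = 0 by rewrite row_mx0.
  by apply: (row_free_inj fW); rewrite mul0mx.
have uS : row_full (col_mx K W).
  rewrite -col_leq_rank (eqP fS) mxrank_ker rQ.
  have : (d <= n)%N by rewrite -rQ rank_leq_row.
  by move/subnKC->.
exists (W *m A *m pinvmx W), (col_mx K W), (pinvmx (col_mx K W)).
split; [exact: mulmxVp | exact: mulVpmx |].
by rewrite mul_col_mx mul_block_col !mul0mx addr0 add0r CK mulmxKpV.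
Qed.

(** The complement is the kernel of a transposed Krylov matrix of [A^T]. That kernel is invariant
    because [A^T] is killed by the same minimal polynomial. *)
Lemma cyclic_splitting n (A : 'M[k]_n.+1) :
    A \in unitmx -> horner_mx A^-1 (mxminpoly A) = 0 ->
  exists d m (C : 'M_d.+1) (B : 'M_m) (S : 'M_(d.+1 + m, n.+1)) S',
    [/\ revmx k d.+1 *m C *m revmx k d.+1 *m C = 1%:M, S *m S' = 1%:M,
        S' *m S = 1%:M & S *m A = block_mx C 0 0 B *m S].
Proof.
move=> uA AVp0; have Ap0 := mx_root_minpoly A.
have [u au] := cyclic_vector A; have sp := size_mxminpoly A.
(* The cyclic block has positive size, which makes the later induction decrease. *)
have dE := prednK (mxminpoly_nonconstant A); move: sp; rewrite -dE.
move: (degree_mxminpoly A).-1 => d sp.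
have [f uKQ] := krylov_dual (krylov_free sp au).
have pT : horner_mx A^T (mxminpoly A) = 0.
  by rewrite horner_polymx polymx_tr -horner_polymx Ap0 trmx0.
have CK := companion_krylov u sp Ap0.
have DQ : A *m (krylov A^T f d.+1)^T =
          (krylov A^T f d.+1)^T *m (companion d.+1 (mxminpoly A))^T.
  by rewrite -{1}(trmxK A) -!trmx_mul (companion_krylov f sp pT).
have [B [S [S' [? ? ?]]]] := complement_splitting CK DQ uKQ erefl.
exists d, (n.+1 - d.+1)%N, (companion d.+1 (mxminpoly A)), B, S, S'; split=> //.
exact: companion_reverse sp au Ap0 AVp0.
Qed.

End Splitting.

(** * An inverting involution of prescribed determinant *)

Section ReversingInvolution.
Variable k : fieldType.

Lemma intertwine_dim m n (S : 'M[k]_(m, n)) S' :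
  S *m S' = 1%:M -> S' *m S = 1%:M -> m = n.
Proof.
by move=> SS' S'S; apply/eqP; rewrite eqn_leq (mulmx1_min SS') (mulmx1_min S'S).
Qed.

Lemma det_intertwine m n (S : 'M[k]_(m, n)) S' X :
  S *m S' = 1%:M -> S' *m S = 1%:M -> \det (S' *m X *m S) = \det X.
Proof.
move=> SS' S'S; have E := intertwine_dim SS' S'S; subst n.
by rewrite !det_mulmx mulrAC -det_mulmx S'S det1 mul1r.
Qed.

(** Halving [d + m] gains one exactly when both are odd; then [-s] has determinant [- \det s], since
    [m] is odd. *)
Lemma det_sign_adjust m d (s : 'M[k]_m) : \det s = (-1) ^+ m./2 ->
  (-1) ^+ d./2 * \det ((-1) ^+ (odd d && odd m) *: s) = (-1) ^+ (d + m)./2.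
Proof.
move=> ds; rewrite detZ ds halfD !exprD mulrCA; congr (_ * _).
by rewrite -exprM -[LHS]signr_odd oddM oddb -andbA andbb.
Qed.

Lemma reversing_involution n (A A' : 'M[k]_n) :
    A *m A' = 1%:M ->
    (forall h, \rank (polymx A h) = \rank (polymx A' h)) ->
  exists s, [/\ s *m s = 1%:M, s *m A *m s *m A = 1%:M
              & \det s = (-1) ^+ n./2].
Proof.
have [N] := ubnP n; elim: N => // N IHN in n A A' *.
case: n A A' => [|n] A A' ltnN AA' rA.
  by exists 1%:M; split; rewrite ?det1 // [LHS]flatmx0 [RHS]flatmx0.
have [uA _] := mulmx1_unit AA'.
have A'E : A^-1 = A' by rewrite -[RHS](mulKmx uA) AA' mulmx1.
have AVp0 : horner_mx A^-1 (mxminpoly A) = 0.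
  apply/eqP; rewrite -mxrank_eq0 horner_polymx A'E -rA -horner_polymx.
  by rewrite mx_root_minpoly mxrank0.
have [d [m [C [B [S [S' [JC SS' S'S SA]]]]]]] := cyclic_splitting uA AVp0.
move: SA; set J := revmx k d.+1 in JC *; set D := block_mx _ _ _ _ => SA.
have JJ : J *m J = 1%:M by apply: revmxK.
have CC' : C *m (J *m C *m J) = 1%:M by apply: mulmx1C.
have uB : B \in unitmx.
  have /mulmx1_unit[] : D *m (S *m A' *m S') = 1%:M.
    by rewrite !mulmxA -SA -(mulmxA S) AA' mulmx1.
  by rewrite !unitmxE det_ublock unitrM => /andP[].
have SA' : S *m A' = block_mx (J *m C *m J) 0 0 (invmx B) *m S.
  have D'D : block_mx (J *m C *m J) 0 0 (invmx B) *m D = 1%:M.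
    rewrite mulmx_block !(mulmx0, mul0mx, addr0, add0r) JC mulVmx //.
    by rewrite -scalar_mx_block.
  by rewrite -[S in LHS]mul1mx -D'D -(mulmxA _ D) -SA -!mulmxA AA' mulmx1.
(* Ranks add over diagonal blocks, and [C] and its inverse [J *m C *m J] are similar, so their
   contributions cancel. *)
have rB h : \rank (polymx B h) = \rank (polymx (invmx B) h).
  have := rA h; rewrite (rank_polymx_intertwine h SS' S'S SA).
  rewrite (rank_polymx_intertwine h SS' S'S SA') !polymx_block !rank_diag_block_mx.
  have <- : \rank (polymx (J *m C *m J) h) = \rank (polymx C h).
    by apply: (rank_polymx_intertwine h JJ JJ); rewrite !mulmxA JJ mul1mx.
  exact: addnI.
have dmn : (d.+1 + m)%N = n.+1 by apply: intertwine_dim SS' S'S.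
have [|s [ss sBsB ds]] := IHN m B (invmx B) _ (mulmxV uB) rB.
  by rewrite -ltnS; apply: leq_trans ltnN; rewrite ltnS -dmn addSn ltnS leq_addl.
pose e : k := (-1) ^+ (odd d.+1 && odd m); pose X := block_mx J 0 0 (e *: s).
have ee : e * e = 1 by rewrite -expr2 sqrr_sign.
have XX : X *m X = 1%:M.
  rewrite mulmx_block !(mulmx0, mul0mx, addr0, add0r) JJ -scalemxAl -scalemxAr.
  by rewrite scalerA ee scale1r ss -scalar_mx_block.
have XDXD : X *m D *m X *m D = 1%:M.
  rewrite !mulmx_block !(mulmx0, mul0mx, addr0, add0r) JC -!scalemxAl -!scalemxAr.
  by rewrite -!scalemxAl scalerA ee scale1r sBsB -scalar_mx_block.
exists (S' *m X *m S); split.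
- by rewrite !mulmxA -(mulmxA _ S S') SS' mulmx1 -(mulmxA S' X) XX mulmx1.
- rewrite !mulmxA -!(mulmxA _ S A) SA !mulmxA -(mulmxA _ S S') SS' mulmx1.
  by rewrite -!(mulmxA S') XDXD mul1mx.
- rewrite (det_intertwine _ SS' S'S) det_ublock det_revmx det_sign_adjust //.
  by rewrite dmn.
Qed.

End ReversingInvolution.

(** * From matrices back to the special linear group *)

Section SpecialLinear.
Variables (k : fieldType) (V : vectType k).

(** Conjugation by [s1] turns [s1 * s2] into [s2 * s1], its inverse. *)
Lemma real_of_strongly_real (t : SL V) : strongly_real t -> is_real t.
Proof.
move=> [s1 [s2 [h1 h2 ->]]]; exists s1.
have V1 : (s1^-1 = s1)%g by apply: (mulgI s1); rewrite mulgV -[LHS]h1 expgS expg1.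
have V2 : (s2^-1 = s2)%g by apply: (mulgI s2); rewrite mulgV -[LHS]h2 expgS expg1.
by rewrite conjgE -mulgA mulKg invgM V1 V2.
Qed.

Lemma strongly_real_of_real (t : SL V) :
  \dim {:V} <> 2 %[mod 4] -> is_real t -> strongly_real t.
Proof.
set n := \dim {:V} => n4 [g].
pose M (f : SL V) := mxof (vbasis {:V}) (vbasis {:V}) f.
(* Matrices act on row vectors, so products are reversed. *)
have MM f h : M (f * h)%g = M h *m M f by apply/mxof_comp/vbasisP.
have M1 : M 1%g = 1%:M by apply/mxof1/basis_free/vbasisP.
have Minj : injective M.
  by move=> f h /(can_inj (mxofK (vbasisP _) (vbasisP _))) /val_inj.
move=> tg.
have tt' : M t *m M t^-1%g = 1%:M by rewrite -MM mulVg M1.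
have rt h : \rank (polymx (M t) h) = \rank (polymx (M t^-1%g) h).
  apply: (@rank_polymx_intertwine _ _ _ (M g) (M g^-1%g)).
  - by rewrite -MM mulVg M1.
  - by rewrite -MM mulgV M1.
  - by rewrite -!MM -tg conjgE mulVKg.
have [s0 [ss0 st0 ds0]] := reversing_involution tt' rt.
have [s [ss st ds]] : exists s,
    [/\ s *m s = 1%:M, s *m M t *m s *m M t = 1%:M & \det s = 1].
  have [e0|/negbTE e1] := boolP (~~ odd n./2).
    by exists s0; split=> //; rewrite ds0 -signr_odd (negbTE e0).
  (* Here [n./2] is odd, so an even [n] would be 2 mod 4. With [n] odd, negating [s0] flips its
     determinant from -1 to 1. *)
  have on : odd n.
    apply/negPn/negP => on; apply: n4; rewrite -[n]odd_double_half (negbTE on).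
    rewrite -[n./2]odd_double_half (negbFE e1) add0n doubleD -!muln2 -mulnA.
    by rewrite addnC modnMDl.
  exists (- s0); rewrite !mulNmx !mulmxN opprK ss0; split=> //.
    by rewrite !mulNmx opprK.
  rewrite -scaleN1r detZ ds0 -[X in X * _]signr_odd on -[X in _ * X]signr_odd.
  by rewrite (negbFE e1) expr1 mulrN1 opprK.
have dets : lfun_det (hommx (vbasis {:V}) (vbasis {:V}) s) == 1.
  by rewrite /lfun_det hommxK ?vbasisP // ds.
pose sigma := MkSL dets.
have Ms : M sigma = s by rewrite /M /= hommxK ?vbasisP.
have sig2 : (sigma * sigma = 1)%g by apply: Minj; rewrite MM Ms M1.
exists (sigma), (sigma * t)%g; split.
- by rewrite /involution expgS expg1.
- rewrite /involution expgS expg1; apply: Minj; rewrite !MM Ms M1 mulmxA.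
  by apply: mulmx1C; rewrite !mulmxA.
- by rewrite mulgA sig2 mul1g.
Qed.

End SpecialLinear.

Theorem theorem3p1p1 (k : fieldType) (hk : 2%N \notin [pchar k])
    (V : vectType k) (n : nat) (hn : \dim {:V} = n)
    (hmod : n <> 2 %[mod 4]) (t : SL V) :
  is_real t <-> strongly_real t.
Proof.
split; last exact: real_of_strongly_real.
by apply: strongly_real_of_real; rewrite hn.
Qed.
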